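(* Let $s_1,t_1,s_2,t_2>0$ with $s_1=s_2=s$, and let $\Pi$ be the transition operator of the generalized immediate exchange model $IEM(s_1,t_1;s_2,t_2)$. Then: (1) For each $\alpha\in\{+,-,0\}$, $\Pi$ commutes with $K^{\alpha,s_1+t_1}_1+K^{\alpha,s_2+t_2}_2$ on functions $f:\mathbb N^2\to\mathbb R$. (2) $IEM(s,t_1;s,t_2)$ is self-dual with self-duality function $D(k_1,k_2;n_1,n_2)=d_{s+t_1}(k_1,n_1)\,d_{s+t_2}(k_2,n_2)$, where for $r>0$ $$d_r(k,n)=\begin{cases}1 & \text{if } k=0,\\ 0 & \text{if } k>n,\\ \dfrac{n!}{(n-k)!}\,\dfrac{\Gamma(r)}{\Gamma(r+k)} & \text{otherwise.}\end{cases}$$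
   Context: $\mathbb N=\{0,1,2,\dots\}$. The Beta Binomial distribution with parameters $n\in\mathbb N$, $s,t>0$ is the law on $\{0,\dots,n\}$ given by $\mathbb P(k)=\binom{n}{k}\frac{\Gamma(s+k)\Gamma(t+n-k)\Gamma(s+t)}{\Gamma(s)\Gamma(t)\Gamma(s+t+n)}$. Model $IEM(s_1,t_1;s_2,t_2)$: given $(n_1,n_2)\in\mathbb N^2$, let $k_1,k_2$ be independent, $k_i$ Beta Binomial with parameters $n_i,s_i,t_i$. The wealths are split as $(k_1,n_1-k_1;k_2,n_2-k_2)$, the parts $k_1$ and $k_2$ are exchanged, and the two parts of each agent are added, giving $(k_2+n_1-k_1,\;k_1+n_2-k_2)$. The one-step transition operator on functions $f:\mathbb N^2\to\mathbb R$ is $$\Pi f(n_1,n_2)=\mathbb E\, f(k_2+n_1-k_1,\;k_1+n_2-k_2).$$ Operators: for $\kappa>0$ and $f:\mathbb N\to\mathbb R$, $$K^{+,\kappa}f(n)=(\kappa+n)f(n+1),\quad K^{-,\kappa}f(n)=n f(n-1),\quad K^{0,\kappa}f(n)=\left(\tfrac{\kappa}{2}+n\right)f(n),$$ where $K^{-,\kappa}f(0)=0$. $K^{\alpha,\kappa}_i$ denotes $K^{\alpha,\kappa}$ acting on the $i$-th variable of a function of two variables. Self-duality with function $D$ means: for all $(k_1,k_2),(n_1,n_2)\in\mathbb N^2$, $\big(\Pi D(\cdot\,;n_1,n_2)\big)(k_1,k_2)=\big(\Pi D(k_1,k_2;\cdot)\big)(n_1,n_2)$. *)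

(* Defs.v *)
From HB Require Import structures.
From mathcomp Require Import all_boot all_order all_algebra.
From mathcomp Require Import all_classical all_reals all_analysis.

Set Implicit Arguments.
Unset Strict Implicit.
Unset Printing Implicit Defensive.

Import Order.TTheory GRing.Theory Num.Theory.
Import numFieldNormedType.Exports.

Local Open Scope classical_set_scope.
Local Open Scope ring_scope.

(* Euler's integral, as a real-valued Lebesgue integral. [Rintegral] returns 0
   when the extended-real integral is infinite (which happens for x <= 0), so
   this is the Gamma function for x > 0 only. *)
Definition Gamma (R : realType) (x : R) : R :=
  \int[@lebesgue_measure R]_(u in `]0, +oo[) (u `^ (x - 1) * expR (- u)).

Definition beta_binomial_pmf (R : realType) (n : nat) (s t : R) (k : 'I_n.+1)
    : R :=
  'C(n, k)%:R *
  ((Gamma (s + k%:R) * Gamma (t + (n - k)%N%:R) * Gamma (s + t)) /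
   (Gamma s * Gamma t * Gamma (s + t + n%:R))).

(* The expectation of f (k2 + n1 - k1, k1 + n2 - k2), where k1 and k2 are
   independent, so that their joint mass function is a product. The truncated
   subtractions are exact because k1 <= n1 and k2 <= n2. *)
Definition iem_op (R : realType) (s1 t1 s2 t2 : R) (f : nat * nat -> R)
    (n : nat * nat) : R :=
  \sum_(k1 < n.1.+1) \sum_(k2 < n.2.+1)
    beta_binomial_pmf s1 t1 k1 * beta_binomial_pmf s2 t2 k2 *
    f ((k2 + (n.1 - k1))%N, (k1 + (n.2 - k2))%N).

Variant su11_index := Kplus | Kminus | Kzero.

Definition K_op (R : realType) (a : su11_index) (kappa : R) (f : nat -> R)
    (n : nat) : R :=
  match a with
  | Kplus => (kappa + n%:R) * f n.+1
  | Kminus => if n is m.+1 then m.+1%:R * f m else 0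
  | Kzero => (kappa / 2 + n%:R) * f n
  end.

Definition K_op1 (R : realType) (a : su11_index) (kappa : R)
    (f : nat * nat -> R) (n : nat * nat) : R :=
  K_op a kappa (fun m => f (m, n.2)) n.1.

Definition K_op2 (R : realType) (a : su11_index) (kappa : R)
    (f : nat * nat -> R) (n : nat * nat) : R :=
  K_op a kappa (fun m => f (n.1, m)) n.2.

Definition K_sum (R : realType) (a : su11_index) (kappa1 kappa2 : R)
    (f : nat * nat -> R) (n : nat * nat) : R :=
  K_op1 a kappa1 f n + K_op2 a kappa2 f n.

Definition self_dual (R : realType)
    (P : (nat * nat -> R) -> nat * nat -> R)
    (D : nat * nat -> nat * nat -> R) : Prop :=
  forall k n : nat * nat, P (fun k' => D k' n) k = P (fun n' => D k n') n.

Definition single_duality (R : realType) (r : R) (k n : nat) : R :=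
  if k == 0%N then 1
  else if (n < k)%N then 0
  else n`!%:R / (n - k)`!%:R * (Gamma r / Gamma (r + k%:R)).

Definition product_duality (R : realType) (r1 r2 : R) (k n : nat * nat) : R :=
  single_duality r1 k.1 n.1 * single_duality r2 k.2 n.2.

(* Main.v *)
Require Import Defs.
From HB Require Import structures.
From mathcomp Require Import all_boot all_order all_algebra.
From mathcomp Require Import all_classical all_reals all_analysis.
From mathcomp Require Import measurable_realfun zify ring lra.

Import Order.TTheory GRing.Theory Num.Theory.
Import numFieldNormedType.Exports.
Local Open Scope classical_set_scope.
Local Open Scope ring_scope.

(** Writing [w s k = Gamma (s + k) / (Gamma s * k!)], the Beta Binomial law is
    [w s k * w t (n - k) / w (s + t) n]. The recurrence
    [(k + 1) w s (k + 1) = (s + k) w s k] gives intertwining relations between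
    the Beta Binomial expectation with parameter [n] and those with parameters
    [n + 1] and [n - 1]; summed over the two agents, and because [s1 = s2], they
    say that [Pi] commutes with [K^+] and [K^-]. It commutes with [K^0] because
    the total wealth is conserved.

    For the self-duality, [d_r (k, n) = 'C(n, k) / w r k] satisfies
    [k d = n d - n d (k, n - 1)]. Together with the commutation with [K^-], this
    shows that the difference [X (k, n)] of the two sides of the duality
    relation satisfies
    [(|n| - |k|) X (k, n) = n1 X (k, n - e1) + n2 X (k, n - e2)], so by induction
    on [|n|] it vanishes unless [|n| = |k|]. In that case [D (k, n)] is
    concentrated on [k = n], and the relation is the detailed balance of [Pi]
    for the measure [w (s + t1) n1 * w (s + t2) n2]. *)

(** * The Gamma function *)

(** The rays [[a + 1/(n+1), +oo[] increase to []a, +oo[], so monotone convergence reduces the claim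
    to closed rays. Only the right limit of [F] at [a] enters, which admits an integrand singular
    there. *)
Lemma ge0_FTC_oy (R : realType) (f F : R -> R) (a m l : R) :
  (forall x, a < x -> 0 <= f x) ->
  {in `]a, +oo[, continuous f} ->
  (forall x, a < x -> is_derive x 1 F (f x)) ->
  F x @[x --> a^'+] --> m -> F x @[x --> +oo] --> l ->
  (\int[lebesgue_measure]_(x in `]a, +oo[) (f x)%:E = (l - m)%:E)%E.
Proof.
move=> f0 cf dF Fa Fy.
pose b n : R := a + n.+1%:R^-1.
have b_gt n : a < b n by rewrite ltrDl invr_gt0.
have bE : `]a, +oo[%classic = \bigcup_n `[b n, +oo[%classic.
  apply/seteqP; split => x /=; rewrite ?in_itv/= ?andbT.
    move=> ax; near \oo => n; exists n => //=; rewrite in_itv/= andbT.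
    rewrite /b -lerBrDl ltW//; near: n.
    have xa : 0 < x - a by rewrite subr_gt0.
    exact: near_infty_natSinv_lt (PosNum xa).
  by case=> n _ /=; rewrite in_itv/= andbT; exact: lt_le_trans.
have ib n : (\int[lebesgue_measure]_(x in `[b n, +oo[) (f x)%:E = (l - F (b n))%:E)%E.
  rewrite (@ge0_continuous_FTC2y _ f F _ l)//.
  - by move=> x bx; apply: f0; exact: lt_le_trans bx.
  - apply: continuous_in_subspaceT => x; rewrite inE/= in_itv/= andbT => bx.
    by apply: cf; rewrite in_itv/= andbT; exact: lt_le_trans bx.
  - by move=> x bx; have [] := dF x (lt_trans (b_gt n) bx).
  - apply: cvg_at_right_filter; apply: differentiable_continuous.
    by apply/derivable1_diffP; have [] := dF _ (b_gt n).
  - move=> x; rewrite in_itv/= andbT => bx.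
    by rewrite derive1E; have [_ ->] := dF x (lt_trans (b_gt n) bx).
have : (\int[lebesgue_measure]_(x in `[b i, +oo[) (f x)%:E @[i --> \oo] -->
    \int[lebesgue_measure]_(x in `]a, +oo[) (f x)%:E)%E.
  rewrite bE; apply: ge0_nondecreasing_set_cvg_integral => //.
  - apply/nondecreasing_seqP => n; apply/subsetPset; apply: subset_itvr.
    by rewrite bnd_simp lerD2l lef_pV2 ?posrE ?ltr0n// ler_nat.
  - move=> n; apply/measurable_EFinP.
    apply: subspace_continuous_measurable_fun => //.
    apply: continuous_in_subspaceT => x; rewrite inE/= in_itv/= andbT => bx.
    by apply: cf; rewrite in_itv/= andbT; exact: lt_le_trans bx.
  - move=> n x /=; rewrite in_itv/= andbT => bx; rewrite lee_fin f0//.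
    exact: lt_le_trans bx.
move=> /cvg_lim <-//; apply/cvg_lim => //.
under eq_fun do rewrite ib.
apply: cvg_EFin; first exact: nearW.
apply: cvgB; first exact: cvg_cst.
move/cvg_at_rightP: Fa; apply; split => //.
rewrite -[X in _ --> X]addr0; apply: cvgD; first exact: cvg_cst.
exact: cvg_harmonic.
Unshelve. all: by end_near. Qed.

(** This is [ln y <= y - 1] at [y = u / (2 * x)]; the factor 2 leaves half of the decay of
    [expR (- u)] for domination. *)
Lemma powR_le_expR (R : realType) (x u : R) : 0 < x -> 0 < u ->
  u `^ x <= expR (x * (ln (2 * x) - 1)) * expR (u / 2).
Proof.
move=> x0 u0; have x20 : 0 < 2 * x by rewrite mulr_gt0.
have v0 : 0 < u / (2 * x) by rewrite divr_gt0.
rewrite /powR gt_eqF// -expRD ler_expR.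
have : ln (u / (2 * x)) <= u / (2 * x) - 1.
  by rewrite -[X in ln X](subrKC 1) le_ln1Dx// ltrBDr addNr.
rewrite ln_div ?posrE// => h.
have -> : u / 2 = x * (u / (2 * x)) by field; rewrite gt_eqF.
by rewrite -mulrDr ler_pM2l//; lra.
Qed.

Lemma itv_oy_continuous_measurable (R : realType) (a : R) (f : R -> R) :
  {in `]a, +oo[, continuous f} -> measurable_fun `]a, +oo[ (EFin \o f).
Proof.
move=> cf; apply/measurable_EFinP; apply: open_continuous_measurable_fun => // u.
by rewrite inE => u0; exact: cf.
Qed.

Section gamma_function.
Context {R : realType}.
Local Notation mu := (@lebesgue_measure R).
Implicit Types x u : R.

Lemma is_derive_gamma_integrand x u : 0 < u ->
  is_derive u 1 (fun v => v `^ x * expR (- v))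
    (x * (u `^ (x - 1) * expR (- u)) - u `^ x * expR (- u)).
Proof.
move=> u0; have d := is_derive1_powR x u0.
by apply: is_derive_eq; rewrite /GRing.scale/=; ring.
Qed.

Lemma continuous_gamma_integrand x :
  {in `]0, +oo[, continuous (fun u => u `^ x * expR (- u))}.
Proof.
move=> u; rewrite in_itv/= andbT => u0; apply: differentiable_continuous.
by apply/derivable1_diffP; have [] := is_derive_gamma_integrand x u u0.
Qed.

Lemma gamma_integrand_ge0 x u : 0 <= u `^ x * expR (- u).
Proof. by rewrite mulr_ge0 ?powR_ge0 ?expR_ge0. Qed.

Lemma cvgr_expRNhalf : expR (- (u / 2)) @[u --> +oo] --> (0 : R).
Proof.
apply: (@cvg_comp _ _ _ (fun u => u / 2) (fun v => expR (- v)) _ (pinfty_nbhs R)).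
  exact: gt0_cvgMly.
exact: cvgr_expR.
Qed.

(* With [C] such that [u^x exp(-u) <= C exp(-u/2)], the derivative of
   [u^x exp(-u) - 2 C exp(-u/2)] is the sum of the nonnegative functions
   [x u^(x-1) exp(-u)] and [C exp(-u/2) - u^x exp(-u)], so that the fundamental
   theorem of calculus for nonnegative functions yields both the finiteness
   and the recurrence, whatever the singularity at 0. *)
Lemma gamma_recurrence x : 0 < x ->
  (\int[mu]_(u in `]0%R, +oo[) (u `^ x * expR (- u))%:E < +oo /\
  \int[mu]_(u in `]0%R, +oo[) (u `^ x * expR (- u))%:E =
  x%:E * \int[mu]_(u in `]0%R, +oo[) (u `^ (x - 1) * expR (- u))%:E)%E.
Proof.
move=> x0; pose C := expR (x * (ln (2 * x) - 1)).
pose k u := u `^ x * expR (- u).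
pose h u := x * (u `^ (x - 1) * expR (- u)).
pose e u := C * expR (- (u / 2)).
have k_le u : 0 < u -> k u <= e u.
  move=> u0; rewrite /k /e.
  have -> : expR (- (u / 2)) = expR (u / 2) * expR (- u).
    by rewrite -expRD; congr expR; field.
  by rewrite mulrA ler_wpM2r ?expR_ge0// powR_le_expR.
have k0 u : 0 <= k u by exact: gamma_integrand_ge0.
have h0 u : 0 <= h u by apply: mulr_ge0; [exact: ltW|exact: gamma_integrand_ge0].
have ce : continuous e.
  by move=> u; apply: differentiable_continuous; exact/derivable1_diffP.
have ck : {in `]0, +oo[, continuous k} by exact: continuous_gamma_integrand.
have ch : {in `]0, +oo[, continuous h}.
  by move=> u u0; apply: cvgM; [exact: cvg_cst|exact: continuous_gamma_integrand].
have cek : {in `]0, +oo[, continuous (e \- k)}.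
  by move=> u u0; apply: cvgB; [exact: ce|exact: ck].
have E2y : (- 2 * e u) @[u --> +oo] --> (0 : R).
  rewrite -(mulr0 (- 2 : R)); apply: cvgM; first exact: cvg_cst.
  by rewrite -(mulr0 C); apply: cvgM; [exact: cvg_cst|exact: cvgr_expRNhalf].
have E20 : (- 2 * e u) @[u --> 0^'+] --> - 2 * C.
  have -> : - 2 * C = - 2 * e 0 by rewrite /e mul0r oppr0 expR0 mulr1.
  by apply: cvg_at_right_filter; apply: cvgM; [exact: cvg_cst|exact: ce].
have de u : is_derive u 1 (fun v => - 2 * e v) (e u).
  by rewrite /e; apply: is_derive_eq; rewrite /GRing.scale/=; field.
have ie : (\int[mu]_(u in `]0%R, +oo[) (e u)%:E = (2 * C)%:E)%E.
  rewrite (@ge0_FTC_oy _ e (fun u => - 2 * e u) 0 (- 2 * C) 0)//.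
  - by congr EFin; ring.
  - by move=> u _; rewrite mulr_ge0 ?expR_ge0.
have k_0 : k u @[u --> 0^'+] --> (0 : R).
  rewrite -[X in _ --> X](mul0r (expR (- 0))). 
  apply: (@cvgM _ _ _ _ (fun u => u `^ x) (fun u => expR (- u))).
    exact: powR_cvg0.
  have cexp : continuous (fun u : R => expR (- u)).
    by move=> u; apply: differentiable_continuous; exact/derivable1_diffP.
  exact: cvg_at_right_filter (cexp 0).
have k_y : k u @[u --> +oo] --> (0 : R).
  apply: (@squeeze_cvgr _ _ _ _ (fun=> 0) e); last 2 first.
  - exact: cvg_cst.
  - by rewrite -(mulr0 C); apply: cvgM; [exact: cvg_cst|exact: cvgr_expRNhalf].
  by near=> u; rewrite k0 k_le.
have ihek : (\int[mu]_(u in `]0%R, +oo[) ((h u)%:E + ((e \- k) u)%:E) = (2 * C)%:E)%E.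
  have -> : 2 * C = 0 - - 2 * C by ring.
  apply: (@ge0_FTC_oy _ (fun u => h u + (e \- k) u) (fun u => k u + - 2 * e u)) => //.
  - by move=> u u0; rewrite addr_ge0 //= subr_ge0 k_le.
  - by move=> u u0; apply: cvgD; [exact: ch|exact: cek].
  - move=> u u0.
    have dk : is_derive u 1 k (h u - k u) by exact: is_derive_gamma_integrand.
    by apply: is_derive_eq; rewrite /=; ring.
  - by rewrite -[X in _ --> X]add0r; apply: cvgD.
  - by rewrite -[X in _ --> X]add0r; apply: cvgD.
have ikek : (\int[mu]_(u in `]0%R, +oo[) ((k u)%:E + ((e \- k) u)%:E) = (2 * C)%:E)%E.
  by rewrite -ie; apply: eq_integral => u _; rewrite -EFinD/= subrKC.
have ek0 u : `]0, +oo[%classic u -> (0 <= ((e \- k) u)%:E)%E.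
  by rewrite /= in_itv/= andbT => u0; rewrite lee_fin subr_ge0 k_le.
move: ihek ikek; rewrite !ge0_integralD//=; try exact: itv_oy_continuous_measurable;
  try by move=> u _; rewrite lee_fin.
have := @integral_ge0 _ _ _ mu `]0, +oo[ _ ek0.
have : (0 <= \int[mu]_(u in `]0%R, +oo[) (h u)%:E)%E.
  by apply: integral_ge0 => u _; rewrite lee_fin h0.
have : (0 <= \int[mu]_(u in `]0%R, +oo[) (k u)%:E)%E.
  by apply: integral_ge0 => u _; rewrite lee_fin k0.
have -> : (\int[mu]_(u in `]0%R, +oo[) (h u)%:E =
  x%:E * \int[mu]_(u in `]0%R, +oo[) (u `^ (x - 1) * expR (- u))%:E)%E.
  under eq_integral do rewrite EFinM.
  rewrite ge0_integralZl_EFin//.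
  - by move=> u _; rewrite lee_fin gamma_integrand_ge0.
  - by apply: itv_oy_continuous_measurable; exact: continuous_gamma_integrand.
  - exact: ltW.
move: (\int[mu]_(u in `]0%R, +oo[) (k u)%:E)%E => B.
move: (x%:E * _)%E => A.
move: (\int[mu]_(u in _) _)%E => D.
(* [A + D] and [B + D] both equal the finite [2 * C], so all three integrals are finite and [D]
   cancels. *)
by case: A B D => [a| |] [b| |] [d| |]// _ _ _ [ad] [bd]; split; rewrite ?ltry//; congr EFin; lra.
Unshelve. all: by end_near. Qed.


End gamma_function.

Lemma GammaD1 (R : realType) (x : R) : 0 < x -> Gamma (x + 1) = x * Gamma x.
Proof.
move=> x0; rewrite /Gamma /Rintegral addrK.
have [_ ->] := gamma_recurrence x x0.
(* An infinite integral would give 0 on both sides, since [fine] sends infinities to 0. *)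
by case: (\int[_]_(_ in _) _)%E => [r| |]//=; rewrite ?gt0_muley ?gt0_muleNy ?lte_fin//= mulr0.
Qed.

(** The recurrence turns finiteness of the integral of [u^x exp(-u)] into finiteness of the one with
    exponent [x - 1]. For positivity, [u^(x-1) >= u^(-1) >= 1/2] and [exp(-u) >= exp(-2)] on
    [[1, 2]]. *)
Lemma Gamma_gt0 (R : realType) (x : R) : 0 < x -> 0 < Gamma x.
Proof.
move=> x0; rewrite /Gamma /Rintegral fine_gt0//; apply/andP; split; last first.
  have [+ E] := gamma_recurrence x x0; rewrite {}E.
  by case: (\int[_]_(_ in _) _)%E => [r| |]; rewrite ?ltry// gt0_muley ?lte_fin.
have mg := itv_oy_continuous_measurable _ _ _ (continuous_gamma_integrand (x - 1)).
apply: (@lt_le_trans _ _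
    (\int[lebesgue_measure]_(u in `[1%R, 2%R]) (expR (- 2) / 2)%:E)%E).
  rewrite integral_cst//= lebesgue_measure_itv/= lte_fin ltr1n.
  by rewrite -EFinB -EFinM lte_fin !mulr_gt0 ?expR_gt0// subr_gt0 ltr1n.
apply: (@le_trans _ _
    (\int[lebesgue_measure]_(u in `[1%R, 2%R]) (u `^ (x - 1) * expR (- u))%:E)%E).
  apply: ge0_le_integral => //=.
  - apply: measurable_funS mg => //.
    by move=> u /=; rewrite !in_itv/= andbT => /andP[/(lt_le_trans _)->].
  - move=> u; rewrite in_itv/= => /andP[u1 u2].
    have u0 : 0 < u by exact: lt_le_trans u1.
    rewrite lee_fin mulrC ler_pM ?expR_ge0 ?invr_ge0// ?ler_expR ?lerN2//.
    apply: (@le_trans _ _ (u `^ (-1))); last by rewrite ler_powR// lerBrDr addNr ltW.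
    by rewrite (powR_inv1 (ltW u0)) lef_pV2 ?posrE.
apply: ge0_subset_integral => //.
- by move=> u _; rewrite lee_fin gamma_integrand_ge0.
- by move=> u /=; rewrite !in_itv/= andbT => /andP[/(lt_le_trans _)->].
Qed.

(** * Beta Binomial expectations *)

(* The k-th coefficient of the binomial series of (1 - z)^(-s): the Beta
   Binomial weights become [w s k * w t (n - k) / w (s + t) n]. *)
Definition nb_weight {R : realType} (s : R) (k : nat) : R :=
  Gamma (s + k%:R) / (Gamma s * k`!%:R).

Section nb_weight.
Context {R : realType}.
Implicit Types (s t : R) (k n : nat).

Lemma nb_weightS s k : 0 < s ->
  k.+1%:R * nb_weight s k.+1 = (s + k%:R) * nb_weight s k.
Proof.
move=> s0; have skE : s + k.+1%:R = s + k%:R + 1 by rewrite -natr1 addrA.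
rewrite /nb_weight skE GammaD1 ?ltr_wpDr//.
have := Gamma_gt0 _ _ s0; have : k`!%:R != 0 :> R by rewrite pnatr_eq0 -lt0n fact_gt0.
have : k.+1%:R != 0 :> R by rewrite pnatr_eq0.
rewrite factS natrM => h2 h1 /lt0r_neq0 h3.
move: (Gamma s) (Gamma _) (k`!%:R) h1 h2 h3 => a b c h1 h2 h3.
by field; rewrite h1 h3 nat1r h2.
Qed.

Lemma nb_weight_neq0 s k : 0 < s -> nb_weight s k != 0.
Proof.
move=> s0; rewrite gt_eqF// /nb_weight divr_gt0 ?mulr_gt0 ?Gamma_gt0 ?ltr_wpDr// ltr0n fact_gt0.
Qed.

Lemma beta_binomial_pmfE s t n (k : 'I_n.+1) : 0 < s -> 0 < t ->
  beta_binomial_pmf s t k =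
  nb_weight s k * nb_weight t (n - k)%N / nb_weight (s + t) n.
Proof.
move=> s0 t0; rewrite /beta_binomial_pmf /nb_weight.
have /(congr1 (fun m : nat => m%:R : R)) := bin_fact (ltn_ord k : (k <= n)%N).
rewrite !natrM => <-.
have G0 (x : R) : 0 < x -> Gamma x != 0 by move/Gamma_gt0/lt0r_neq0.
have f0 m : m`!%:R != 0 :> R by rewrite pnatr_eq0 -lt0n fact_gt0.
have : 'C(n, k)%:R != 0 :> R by rewrite pnatr_eq0 -lt0n bin_gt0 -ltnS.
have st0 : 0 < s + t by rewrite addr_gt0.
move: (G0 _ s0) (G0 _ t0) (G0 _ st0) (G0 (s + t + n%:R) (ltr_wpDr (ler0n _ _) st0)).
move: (f0 k) (f0 (n - k)%N).
move: (Gamma s) (Gamma t) (Gamma (s + t)) (Gamma (s + t + n%:R)) => a b c d.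
move: (Gamma (s + k%:R)) (Gamma (t + _)) ('C(n, k)%:R : R) (k`!%:R : R) ((n - k)`!%:R : R).
move=> p q u v w v0 w0 a0 b0 c0 d0 u0.
by field; rewrite v0 w0 a0 b0 c0 d0 u0.
Qed.

(** The binomial coefficient absorbs the three cases: it vanishes for [k > n], and at [k = 0] both
    it and the weight are 1. *)
Lemma single_dualityE s k n : 0 < s ->
  single_duality s k n = 'C(n, k)%:R / nb_weight s k.
Proof.
move=> s0; rewrite /single_duality /nb_weight.
have G0 (x : R) : 0 < x -> Gamma x != 0 by move/Gamma_gt0/lt0r_neq0.
have f0 m : m`!%:R != 0 :> R by rewrite pnatr_eq0 -lt0n fact_gt0.
case: eqVneq => [->|k0]; first by rewrite addr0 bin0 fact0 mulr1 divff ?invr1 ?mulr1 ?G0.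
case: ltnP => [nk|kn]; first by rewrite bin_small// mul0r.
rewrite -(bin_fact kn) !natrM.
move: (G0 _ s0) (G0 (s + k%:R) (ltr_wpDr (ler0n _ _) s0)) (f0 k) (f0 (n - k)%N).
move: (Gamma s) (Gamma _) ('C(n, k)%:R : R) (k`!%:R : R) ((n - k)`!%:R : R).
by move=> a b c d e a0 b0 d0 e0; field; rewrite a0 b0 d0 e0.
Qed.

End nb_weight.

Section bb_expectation.
Context {R : realType}.
Variables s t : R.
Hypotheses (s0 : 0 < s) (t0 : 0 < t).
Implicit Types (k l n : nat) (g h : nat -> nat -> R).

(** The function takes both parts [k] and [n - k] as separate arguments, so that a unit can be added
    to or removed from either one. *)
Definition bb_expect n g : R :=
  \sum_(k < n.+1) beta_binomial_pmf s t k * g k (n - k)%N.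

Lemma eq_bb_expect n g h : (forall k l, (k + l)%N = n -> g k l = h k l) ->
  bb_expect n g = bb_expect n h.
Proof. by move=> gh; apply: eq_bigr => k _; rewrite gh// subnKC// -ltnS. Qed.

Lemma bb_expectD n g h :
  bb_expect n (fun k l => g k l + h k l) = bb_expect n g + bb_expect n h.
Proof. by rewrite -big_split/=; apply: eq_bigr => k _; rewrite mulrDr. Qed.

Lemma bb_expectZ n (c : R) g :
  bb_expect n (fun k l => c * g k l) = c * bb_expect n g.
Proof. by rewrite mulr_sumr; apply: eq_bigr => k _; rewrite mulrCA. Qed.

Definition nb_conv n g : R :=
  \sum_(k < n.+1) nb_weight s k * nb_weight t (n - k)%N * g k (n - k)%N.

Lemma bb_expectE n g : bb_expect n g = nb_conv n g / nb_weight (s + t) n.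
Proof.
rewrite mulr_suml; apply: eq_bigr => k _.
by rewrite beta_binomial_pmfE// mulrAC.
Qed.

(** The term [k = 0] vanishes; after shifting the index, the recurrence of [nb_weight s] turns the
    factor [k + 1] into [s + k]. *)
Lemma nb_convMl n g : nb_conv n.+1 (fun k l => k%:R * g k l) =
  nb_conv n (fun k l => (s + k%:R) * g k.+1 l).
Proof.
rewrite /nb_conv big_ord_recl mul0r mulr0 add0r; apply: eq_bigr => k _.
rewrite lift0 subSS.
have := nb_weightS s k s0.
move: (nb_weight s k.+1) (nb_weight s k) (nb_weight t _) (g _ _) => a b c d ab.
by transitivity ((s + k%:R) * b * (c * d)); [rewrite -ab|]; ring.
Qed.

Lemma nb_convMr n g : nb_conv n.+1 (fun k l => l%:R * g k l) =
  nb_conv n (fun k l => (t + l%:R) * g k l.+1).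
Proof.
rewrite /nb_conv big_ord_recr/= subnn mul0r mulr0 addr0; apply: eq_bigr => k _.
rewrite (subSn (leq_ord k)).
have := nb_weightS t (n - k) t0.
move: (nb_weight s k) (nb_weight t (n - k).+1) (nb_weight t (n - k)) (g _ _) => a b c d bc.
by transitivity ((t + (n - k)%:R) * c * (a * d)); [rewrite -bc|]; ring.
Qed.

Lemma nb_convD n g h :
  nb_conv n (fun k l => g k l + h k l) = nb_conv n g + nb_conv n h.
Proof. by rewrite -big_split/=; apply: eq_bigr => k _; rewrite mulrDr. Qed.

Lemma eq_nb_conv n g h : (forall k l, (k + l)%N = n -> g k l = h k l) ->
  nb_conv n g = nb_conv n h.
Proof. by move=> gh; apply: eq_bigr => k _; rewrite gh// subnKC// -ltnS. Qed.

Lemma nb_convZ n (c : R) g :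
  nb_conv n (fun k l => c * g k l) = c * nb_conv n g.
Proof. by rewrite mulr_sumr; apply: eq_bigr => k _; rewrite mulrCA. Qed.

(** In each term of [nb_conv n.+1 g] the factor [n.+1] is [k + l]; each summand is then shifted
    separately. *)
Lemma nb_convS n g : n.+1%:R * nb_conv n.+1 g =
  nb_conv n (fun k l => (s + k%:R) * g k.+1 l + (t + l%:R) * g k l.+1).
Proof.
rewrite nb_convD -nb_convMl -nb_convMr -nb_convD -nb_convZ.
by apply: eq_nb_conv => k l <-; rewrite natrD mulrDl.
Qed.

(** With [w] the weight of parameter [s + t], its recurrence gives
    [(s + t + n) / w (n + 1) = (n + 1) / w n], which reduces the claim to [nb_convS]. *)
Lemma bb_expect_raise n g :
  (s + t + n%:R) * bb_expect n.+1 g =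
  bb_expect n (fun k l => (s + k%:R) * g k.+1 l + (t + l%:R) * g k l.+1).
Proof.
have st0 : 0 < s + t by rewrite addr_gt0.
rewrite !bb_expectE -nb_convS; have := nb_weightS _ n st0.
move: (nb_weight_neq0 _ n st0) (nb_weight_neq0 _ n.+1 st0).
move: (nb_weight _ n) (nb_weight _ n.+1) (nb_conv _ _) => v u X v0 u0 uv.
apply: (mulIf v0); rewrite divfK// mulrAC -uv.
by rewrite -mulrA (mulrCA u) divff// mulr1.
Qed.

(** Shifting both summands undoes the predecessors and leaves the factor
    [(s + k) + (t + l) = s + t + n], which is constant and leaves the sum. A predecessor of 0 always
    comes with coefficient 0. *)
Lemma bb_expect_lower n g :
  bb_expect n (fun k l => k%:R * g k.-1 l + l%:R * g k l.-1) =
  n%:R * bb_expect n.-1 g.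
Proof.
case: n => [|n].
  by rewrite mul0r /bb_expect big_ord1 !mul0r addr0 mulr0.
rewrite !bb_expectE nb_convD (nb_convMl n (fun k l => g k.-1 l)).
rewrite (nb_convMr n (fun k l => g k l.-1)) -nb_convD/=.
transitivity (nb_conv n (fun k l => (s + t + n%:R) * g k l) / nb_weight (s + t) n.+1).
  by congr (_ / _); apply: eq_nb_conv => k l <-; rewrite natrD; ring.
have st0 : 0 < s + t by rewrite addr_gt0.
rewrite nb_convZ; have := nb_weightS _ n st0.
move: (nb_weight_neq0 _ n st0) (nb_weight_neq0 _ n.+1 st0).
move: (nb_weight _ n) (nb_weight _ n.+1) (nb_conv _ _) => v u X v0 u0 uv.
apply: (mulIf u0); apply: (mulIf v0); rewrite divfK// [LHS]mulrAC -uv.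
by rewrite [RHS]mulrAC -(mulrA _ (X / v)) divfK// mulrAC.
Qed.

End bb_expectation.

Section bb_expect2.
Context {R : realType}.
Variables s1 t1 s2 t2 : R.
Hypotheses (s10 : 0 < s1) (t10 : 0 < t1) (s20 : 0 < s2) (t20 : 0 < t2).
Implicit Types (g h : nat -> nat -> nat -> nat -> R) (n : nat * nat).

Definition bb_expect2 n g : R :=
  bb_expect s1 t1 n.1 (fun k1 l1 => bb_expect s2 t2 n.2 (g k1 l1)).

Lemma eq_bb_expect2 n g h :
  (forall k1 l1 k2 l2, (k1 + l1)%N = n.1 -> (k2 + l2)%N = n.2 ->
    g k1 l1 k2 l2 = h k1 l1 k2 l2) ->
  bb_expect2 n g = bb_expect2 n h.
Proof. by move=> gh; do 2![apply: eq_bb_expect => ? ? ?]; exact: gh. Qed.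

Lemma bb_expect2D n g h :
  bb_expect2 n (fun k1 l1 k2 l2 => g k1 l1 k2 l2 + h k1 l1 k2 l2) =
  bb_expect2 n g + bb_expect2 n h.
Proof. by rewrite -bb_expectD; apply: eq_bb_expect => *; exact: bb_expectD. Qed.

Lemma bb_expect2Z n (c : R) g :
  bb_expect2 n (fun k1 l1 k2 l2 => c * g k1 l1 k2 l2) = c * bb_expect2 n g.
Proof. by rewrite -bb_expectZ; apply: eq_bb_expect => *; exact: bb_expectZ. Qed.

Lemma bb_expect2_raise1 n g :
  (s1 + t1 + n.1%:R) * bb_expect2 (n.1.+1, n.2) g =
  bb_expect2 n (fun k1 l1 k2 l2 =>
    (s1 + k1%:R) * g k1.+1 l1 k2 l2 + (t1 + l1%:R) * g k1 l1.+1 k2 l2).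
Proof.
rewrite [LHS]bb_expect_raise//; apply: eq_bb_expect => k1 l1 _.
by rewrite -!bb_expectZ -bb_expectD.
Qed.

Lemma bb_expect2_raise2 n g :
  (s2 + t2 + n.2%:R) * bb_expect2 (n.1, n.2.+1) g =
  bb_expect2 n (fun k1 l1 k2 l2 =>
    (s2 + k2%:R) * g k1 l1 k2.+1 l2 + (t2 + l2%:R) * g k1 l1 k2 l2.+1).
Proof.
rewrite -[LHS]bb_expectZ; apply: eq_bb_expect => k1 l1 _.
exact: bb_expect_raise.
Qed.

Lemma bb_expect2_lower1 n g :
  bb_expect2 n (fun k1 l1 k2 l2 =>
    k1%:R * g k1.-1 l1 k2 l2 + l1%:R * g k1 l1.-1 k2 l2) =
  n.1%:R * bb_expect2 (n.1.-1, n.2) g.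
Proof.
rewrite -[RHS]bb_expect_lower//; apply: eq_bb_expect => k1 l1 _.
by rewrite bb_expectD !bb_expectZ.
Qed.

Lemma bb_expect2_lower2 n g :
  bb_expect2 n (fun k1 l1 k2 l2 =>
    k2%:R * g k1 l1 k2.-1 l2 + l2%:R * g k1 l1 k2 l2.-1) =
  n.2%:R * bb_expect2 (n.1, n.2.-1) g.
Proof.
rewrite -[RHS]bb_expectZ; apply: eq_bb_expect => k1 l1 _.
exact: bb_expect_lower.
Qed.

End bb_expect2.

(** * The exchange operator and the su(1,1) generators *)

Section iem.
Context {R : realType}.
Variables s t1 t2 : R.
Implicit Types (f h : nat * nat -> R) (n m : nat * nat).

Local Notation Pi := (iem_op s t1 s t2).
Local Notation r1 := (s + t1).
Local Notation r2 := (s + t2).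

Lemma iem_opE f n : Pi f n =
  bb_expect2 s t1 s t2 n (fun k1 l1 k2 l2 => f ((k2 + l1)%N, (k1 + l2)%N)).
Proof.
apply: eq_bigr => k1 _; rewrite mulr_sumr; apply: eq_bigr => k2 _.
by rewrite mulrA.
Qed.

(** The exchange conserves total wealth, so [Pi f n] sees only the pairs with the same total as
    [n]. *)
Lemma eq_iem_op f h n :
  (forall m, (m.1 + m.2 = n.1 + n.2)%N -> f m = h m) -> Pi f n = Pi h n.
Proof.
move=> fh; rewrite !iem_opE; apply: eq_bb_expect2 => k1 l1 k2 l2 kl1 kl2.
by apply: fh; rewrite /= -kl1 -kl2; lia.
Qed.

Lemma iem_opD f h n : Pi (fun m => f m + h m) n = Pi f n + Pi h n.
Proof. by rewrite !iem_opE -bb_expect2D. Qed.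

Lemma iem_opZ (c : R) f n : Pi (fun m => c * f m) n = c * Pi f n.
Proof. by rewrite !iem_opE -bb_expect2Z. Qed.

Lemma iem_op_total f n :
  Pi (fun m => (m.1 + m.2)%:R * f m) n = (n.1 + n.2)%:R * Pi f n.
Proof. by rewrite -iem_opZ; apply: eq_iem_op => m ->. Qed.

Lemma K_sum_lowerE (c1 c2 : R) f n : K_sum Kminus c1 c2 f n =
  n.1%:R * f (n.1.-1, n.2) + n.2%:R * f (n.1, n.2.-1).
Proof. by case: n => -[|n1] [|n2]; rewrite /K_sum/= ?mul0r. Qed.

(** Thus the sum of the [K^0] is multiplication by a function of the total wealth, which is
    conserved. *)
Lemma K_sum_zeroE (c1 c2 : R) f n : K_sum Kzero c1 c2 f n =
  ((c1 + c2) / 2) * f n + (n.1 + n.2)%:R * f n.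
Proof. by case: n => n1 n2; rewrite /K_sum/= /K_op1 /K_op2/= natrD; field. Qed.

Hypotheses (s0 : 0 < s) (t10 : 0 < t1) (t20 : 0 < t2).

(** After the exchange the first agent holds [k2 + l1], and the raised terms give it the coefficient
    [(s + k2) + (t1 + l1)], with the [s] of the second agent. This is the [K^+] coefficient
    [r1 + (k2 + l1)] because both agents share [s]. *)
Lemma iem_op_Kplus f n :
  Pi (K_sum Kplus r1 r2 f) n = K_sum Kplus r1 r2 (Pi f) n.
Proof.
rewrite /K_sum /K_op1 /K_op2/= !iem_opE bb_expect2_raise1// bb_expect2_raise2//.
rewrite -bb_expect2D; apply: eq_bb_expect2 => k1 l1 k2 l2 _ _ /=.
rewrite !addSn !addnS !natrD.
move: (f (_.+1, _)) (f (_, _.+1)) => x y; ring.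
Qed.

Lemma iem_op_Kminus f n :
  Pi (K_sum Kminus r1 r2 f) n = K_sum Kminus r1 r2 (Pi f) n.
Proof.
(* A Leibniz rule: removing a unit from [a + b] means removing it from [a] or from [b]. *)
have natpred (a b : nat) (z : nat -> R) :
    (a + b)%:R * z (a + b).-1 = a%:R * z (a.-1 + b)%N + b%:R * z (a + b.-1)%N.
  rewrite natrD mulrDl; congr (_ + _); first by case: a => [|a]; rewrite ?mul0r ?addSn.
  by case: b => [|b]; rewrite ?mul0r ?addnS.
rewrite (K_sum_lowerE _ _ (Pi f)) !iem_opE -bb_expect2_lower1// -bb_expect2_lower2//.
rewrite -bb_expect2D; apply: eq_bb_expect2 => k1 l1 k2 l2 _ _ /=.
rewrite K_sum_lowerE/= (natpred _ _ (fun a => f (a, _))).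
rewrite (natpred _ _ (fun a => f (_, a))).
by rewrite addrACA [X in X + _ = _]addrC addrACA.
Qed.

Lemma iem_op_K_sum (a : su11_index) f n :
  Pi (K_sum a r1 r2 f) n = K_sum a r1 r2 (Pi f) n.
Proof.
case: a; [exact: iem_op_Kplus|exact: iem_op_Kminus|].
rewrite K_sum_zeroE -iem_op_total -iem_opZ -iem_opD.
by apply: eq_iem_op => m _; rewrite K_sum_zeroE.
Qed.

End iem.

(** * Self-duality *)

(** A common square range, independent of the starting pair, lets the two sums in the detailed
    balance be exchanged. *)
Lemma big_ord_widen2 (V : nmodType) (G : nat -> nat -> V) (a b N : nat) :
  (a <= N)%N -> (b <= N)%N ->
  \sum_(i < a.+1) \sum_(j < b.+1) G i j =
  \sum_(i < N.+1) \sum_(j < N.+1) if (i <= a)%N && (j <= b)%N then G i j else 0.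
Proof.
move=> aN bN; rewrite (big_ord_widen N.+1 (fun i => \sum_(j < b.+1) G i j))//.
rewrite big_mkcond; apply: eq_bigr => i _; rewrite ltnS.
case: (leqP i a) => _ /=; last by rewrite big1.
by rewrite (big_ord_widen N.+1 (G i))// big_mkcond.
Qed.

Section duality.
Context {R : realType}.
Variables s t1 t2 : R.
Hypotheses (s0 : 0 < s) (t10 : 0 < t1) (t20 : 0 < t2).
Implicit Types (f : nat * nat -> R) (k n m : nat * nat).

Local Notation Pi := (iem_op s t1 s t2).
Local Notation r1 := (s + t1).
Local Notation r2 := (s + t2).
Local Notation D := (product_duality r1 r2).

Let r1_gt0 : 0 < r1. Proof. by rewrite addr_gt0. Qed.
Let r2_gt0 : 0 < r2. Proof. by rewrite addr_gt0. Qed.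

Definition pair_weight n : R := nb_weight r1 n.1 * nb_weight r2 n.2.

Lemma pair_weight_neq0 n : pair_weight n != 0.
Proof. by rewrite mulf_neq0 ?nb_weight_neq0. Qed.

(** The factor [pair_weight k] cancels the normalizations of both Beta Binomial laws. *)
Lemma iem_op_indicatorE k n : (k.1 + k.2 = n.1 + n.2)%N ->
  Pi (fun m => (m == n)%:R) k * pair_weight k =
  \sum_(i < (k.1 + k.2).+1) \sum_(j < (k.1 + k.2).+1)
    if [&& (i <= k.1)%N, (j <= k.2)%N & (j + k.1 == n.1 + i)%N]
    then nb_weight s i * nb_weight t1 (k.1 - i) *
      (nb_weight s j * nb_weight t2 (k.2 - j)) else 0.
Proof.
move=> kn; pose G (i j : nat) := if (j + k.1 == n.1 + i)%N
  then nb_weight s i * nb_weight t1 (k.1 - i) *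
    (nb_weight s j * nb_weight t2 (k.2 - j)) else 0.
transitivity (\sum_(i < k.1.+1) \sum_(j < k.2.+1) G i j).
  rewrite mulr_suml; apply: eq_bigr => i _; rewrite mulr_suml; apply: eq_bigr => j _.
  (* Since the totals agree, the first coordinate determines the second. *)
  have -> : (((j + (k.1 - i))%N, (i + (k.2 - j))%N) == n) = (j + k.1 == n.1 + i)%N.
    rewrite -pair_eqE/=.
    by have := ltn_ord i; have := ltn_ord j; lia.
  rewrite /G; case: ifP => _; last by rewrite mulr0 mul0r.
  rewrite !beta_binomial_pmfE// mulr1 mulf_div divfK//.
  exact: pair_weight_neq0.
rewrite (big_ord_widen2 _ G _ _ (k.1 + k.2)) ?leq_addr ?leq_addl//.
by apply: eq_bigr => i _; apply: eq_bigr => j _; rewrite /G; case: (i <= _)%N; case: (j <= _)%N.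
Qed.

(** The move from [k] to [n] giving away [(i, j)] is undone by the move from [n] to [k] giving away
    [(j, i)]. The kept parts coincide, and both given parts are weighted by the same
    [nb_weight s]. *)
Lemma iem_op_reversible k n : (k.1 + k.2 = n.1 + n.2)%N ->
  Pi (fun m => (m == n)%:R) k * pair_weight k =
  Pi (fun m => (m == k)%:R) n * pair_weight n.
Proof.
move=> kn; rewrite !iem_op_indicatorE// -kn [RHS]exchange_big/=.
apply: eq_bigr => i _; apply: eq_bigr => j _.
have -> : [&& j <= n.1, i <= n.2 & i + n.1 == k.1 + j]%N =
          [&& i <= k.1, j <= k.2 & j + k.1 == n.1 + i]%N by lia.
case: ifP => // /and3P[ik jk /eqP ijkn].
have -> : (n.1 - j = k.1 - i)%N by lia.
have -> : (n.2 - i = k.2 - j)%N by lia.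
by rewrite mulrACA (mulrC (nb_weight s i)) -mulrACA.
Qed.

(** If [k] and [n] differ but have equal totals, some coordinate of [k] exceeds that of [n], and its
    binomial coefficient is 0. *)
Lemma product_duality_diag k n : (k.1 + k.2 = n.1 + n.2)%N ->
  D k n = (k == n)%:R / pair_weight n.
Proof.
move=> kn; rewrite /product_duality !single_dualityE// /pair_weight.
case: eqVneq => [->|kn']; first by rewrite !binn mulf_div mul1r.
rewrite mul0r; have [n1k1|k1n1] := ltnP n.1 k.1; first by rewrite bin_small// !mul0r.
rewrite (bin_small (n := n.2)) ?mul0r ?mulr0//.
suff : k.1 != n.1 by lia.
apply: contraNN kn' => /eqP k1; rewrite -pair_eqE/= k1 eqxx/=; lia.
Qed.

(** Pascal's rule combined with [n 'C(n-1, k-1) = k 'C(n, k)]. *)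
Lemma single_duality_lower (r : R) (k n : nat) : 0 < r ->
  k%:R * single_duality r k n =
  n%:R * single_duality r k n - n%:R * single_duality r k n.-1.
Proof.
move=> r0; rewrite !single_dualityE// !mulrA -mulrBl; congr (_ / _).
case: n => [|n].
  by rewrite !mul0r subr0 -natrM; case: k => [|k]; rewrite ?mul0n ?bin0n ?muln0.
apply/eqP; rewrite eq_sym subr_eq -!natrM -natrD eqr_nat; apply/eqP.
case: k => [|k]; first by rewrite !bin0 mul0n.
by rewrite -mul_bin_diag -mulnDr addnC -binS.
Qed.

Lemma product_duality_lower k n :
  (k.1 + k.2)%:R * D k n =
  (n.1 + n.2)%:R * D k n - K_sum Kminus r1 r2 (D k) n.
Proof.
rewrite K_sum_lowerE /product_duality/= !natrD.
move: (single_duality_lower r1 k.1 n.1 r1_gt0) (single_duality_lower r2 k.2 n.2 r2_gt0).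
move: (single_duality r1 k.1 n.1) (single_duality r1 k.1 n.1.-1).
move: (single_duality r2 k.2 n.2) (single_duality r2 k.2 n.2.-1) => c d a b h1 h2.
by rewrite mulrDl (mulrA k.1%:R) h1 (mulrCA k.2%:R) h2; ring.
Qed.

(** [Pi] acts on the first argument of [D]: the factor [|k|] passes through by conservation, and [n]
    is a parameter. *)
Lemma iem_op_dual_lower k n :
  (n.1 + n.2)%:R * Pi (fun m => D m n) k - (k.1 + k.2)%:R * Pi (fun m => D m n) k =
  n.1%:R * Pi (fun m => D m (n.1.-1, n.2)) k + n.2%:R * Pi (fun m => D m (n.1, n.2.-1)) k.
Proof.
apply/eqP; rewrite subr_eq -iem_op_total -3!iem_opZ -2!iem_opD; apply/eqP.
apply: eq_iem_op => m _.
by rewrite product_duality_lower K_sum_lowerE subrKC.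
Qed.

(** Now [Pi] acts on the same variable as [K^-], so the commutation with [K^-] comes in. *)
Lemma iem_op_dual_lower' k n :
  (n.1 + n.2)%:R * Pi (D k) n - (k.1 + k.2)%:R * Pi (D k) n =
  n.1%:R * Pi (D k) (n.1.-1, n.2) + n.2%:R * Pi (D k) (n.1, n.2.-1).
Proof.
rewrite -(K_sum_lowerE r1 r2 (Pi (D k))) -iem_op_K_sum//.
apply/eqP; rewrite subr_eq -iem_op_total -iem_opZ -iem_opD; apply/eqP.
by apply: eq_iem_op => m _; rewrite product_duality_lower subrKC.
Qed.

Lemma iem_op_self_dual : self_dual Pi D.
Proof.
move=> k n; have [N leN] := ubnP (n.1 + n.2); elim: N n leN => // N IH n leN.
have [kn|kn] := eqVneq (k.1 + k.2)%N (n.1 + n.2)%N.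
  transitivity ((pair_weight n)^-1 * Pi (fun m => (m == n)%:R) k).
    rewrite -iem_opZ; apply: eq_iem_op => m mk.
    by rewrite product_duality_diag ?mk// mulrC.
  transitivity ((pair_weight k)^-1 * Pi (fun m => (m == k)%:R) n); last first.
    rewrite -iem_opZ; apply: eq_iem_op => m mn.
    rewrite product_duality_diag ?mn// eq_sym mulrC.
    (* The weight is taken at [m] on one side and at [k] on the other; the indicator identifies
       them. *)
    by case: eqVneq => [->|_]; rewrite ?mul0r.
  apply: (mulfI (pair_weight_neq0 n)); apply: (mulfI (pair_weight_neq0 k)).
  rewrite mulVKf ?pair_weight_neq0// mulrCA mulVKf ?pair_weight_neq0//.
  by rewrite mulrC iem_op_reversible// mulrC.
have nk0 : (n.1 + n.2)%:R - (k.1 + k.2)%:R != 0 :> R.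
  by rewrite subr_eq0 eqr_nat eq_sym.
apply: (mulfI nk0); rewrite !mulrBl iem_op_dual_lower iem_op_dual_lower'.
congr (_ + _).
  (* When [n.1 = 0] the predecessor does not decrease the total, but the coefficient is 0. *)
  have [->|n1_gt0] := posnP n.1; first by rewrite !mul0r.
  by congr (_ * _); apply: IH => /=; lia.
have [->|n2_gt0] := posnP n.2; first by rewrite !mul0r.
by congr (_ * _); apply: IH => /=; lia.
Qed.

End duality.

Theorem theorem3p1 (R : realType) (s s1 t1 s2 t2 : R)
    (s1_gt0 : 0 < s1) (t1_gt0 : 0 < t1) (s2_gt0 : 0 < s2) (t2_gt0 : 0 < t2)
    (s1E : s1 = s) (s2E : s2 = s) :
  (forall (a : su11_index) (f : nat * nat -> R) (n : nat * nat),
     iem_op s1 t1 s2 t2 (K_sum a (s1 + t1) (s2 + t2) f) n =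
     K_sum a (s1 + t1) (s2 + t2) (iem_op s1 t1 s2 t2 f) n) /\
  self_dual (iem_op s t1 s t2) (product_duality (s + t1) (s + t2)).
Proof.
subst s1 s2; split; last exact: iem_op_self_dual.
by move=> a f n; exact: iem_op_K_sum.
Qed.
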